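(* Suppose that $f(x,y)=\langle F(x),\,y-x\rangle$ for some continuously differentiable map $F:\mathbb{R}^n \to \mathbb{R}^n$. If $B \subseteq \mathbb{R}^n$ is a nonempty convex compact set such that $B \subseteq \mathcal{C}$, then for any $\alpha >0$ the gap function $\varphi_\alpha$ is Lipschitz continuous on $B$ with constant $$L_1 + \alpha^{-1}\,L_1\,L_3(\alpha),$$ where $$L_1 = \max_{x \in B} \| F(x) \|, \qquad L_3(\alpha) = \max_{x \in B} \| \alpha\,I - \nabla F(x) \|,$$ and $\nabla F(x)$ denotes the Jacobian matrix of $F$ at $x$.
   Context: $\mathcal{C}\subseteq\mathbb{R}^n$ is a nonempty compact convex set and $f:\mathbb{R}^n\times\mathbb{R}^n\to\mathbb{R}$ is a bifunction (here of the variational-inequality form given in the claim). For $\alpha\ge 0$, the gap function is $$\varphi_\alpha(x) := \max_{y \in \mathcal{C}} \left[ -f(x,y) - \frac{\alpha}{2}\,\|y-x\|^2 \right],\qquad x\in\mathbb{R}^n.$$ For vectors, $\|\cdot\|$ and $\langle\cdot,\cdot\rangle$ denote the Euclidean norm and inner product; for matrices, $\|\cdot\|$ is the induced (spectral) norm; $I$ is the $n\times n$ identity matrix. ''Lipschitz continuous on $B$ with constant $K$'' means $|\varphi_\alpha(x)-\varphi_\alpha(x')|\le K\|x-x'\|$ for all $x,x'\in B$. *)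

(* Defs.v *)
From HB Require Import structures.
From mathcomp Require Import all_boot all_order all_algebra.
From mathcomp Require Import all_classical all_reals all_analysis.

Set Implicit Arguments.
Unset Strict Implicit.
Unset Printing Implicit Defensive.

Import Order.TTheory GRing.Theory Num.Theory.
Import numFieldNormedType.Exports.

Local Open Scope classical_set_scope.
Local Open Scope ring_scope.

(* Points of R^n are row vectors. The library norm on 'rV[R]_n is the sup norm,
   so the Euclidean structure is defined here; the topology is the same. *)
Definition dotv (R : realType) (n : nat) (x y : 'rV[R]_n) : R :=
  \sum_(i < n) x 0 i * y 0 i.

Definition enorm (R : realType) (n : nat) (x : 'rV[R]_n) : R :=
  Num.sqrt (dotv x x).

(* The product A v of a matrix with a vector reads v *m A^T on row vectors. *)
Definition opnorm (R : realType) (n : nat) (A : 'M[R]_n) : R :=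
  sup [set enorm (v *m A^T) | v in [set v : 'rV[R]_n | enorm v <= 1]].

(* The library matrix 'J F x acts on row vectors from the right
   ('d F x v = v *m 'J F x), so the usual Jacobian, whose (i, j) entry is the
   partial derivative of F_i with respect to x_j, is its transpose. *)
Definition jacobian_mx (R : realType) (n : nat) (F : 'rV[R]_n -> 'rV[R]_n)
    (x : 'rV[R]_n) : 'M[R]_n :=
  ('J F x)^T.

Definition continuously_differentiable (R : realType) (n : nat)
    (F : 'rV[R]_n -> 'rV[R]_n) : Prop :=
  (forall x, differentiable F x) /\ continuous (jacobian_mx F).

(* The greatest element of A; 0 when A has none. *)
Definition set_max (R : realType) (A : set R) : R :=
  xget 0 [set m | A m /\ ubound A m].

Lemma set_max_eq (R : realType) (A : set R) (m : R) :
  A m -> ubound A m -> set_max A = m.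
Proof.
move=> Am ubm; rewrite /set_max; case: xgetP => [m' _ [Am' ubm']|/(_ m)[]//].
by apply/eqP; rewrite eq_le (ubm _ Am') (ubm' _ Am).
Qed.

Lemma set_max_compact (R : realType) (T : topologicalType) (K : set T)
    (g : T -> R) : K !=set0 -> compact K -> {within K, continuous g} ->
  [set g t | t in K] (set_max [set g t | t in K]) /\
  forall t, K t -> g t <= set_max [set g t | t in K].
Proof.
move=> K0 cK cg; have [c /set_mem Kc gc] := compact_EVT_max K0 cK cg.
have gK t : K t -> g t <= g c by move=> Kt; apply: gc; exact: mem_set.
rewrite (@set_max_eq _ _ (g c)); last by move=> _ [t /gK ? <-].
  by split=> //; exists c.
by exists c.
Qed.

Definition gap_function (R : realType) (n : nat) (C : set 'rV[R]_n)
    (f : 'rV[R]_n -> 'rV[R]_n -> R) (alpha : R) (x : 'rV[R]_n) : R :=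
  set_max [set - f x y - alpha / 2 * enorm (y - x) ^+ 2 | y in C].

Definition lipschitz_with (R : realType) (n : nat) (B : set 'rV[R]_n) (K : R)
    (g : 'rV[R]_n -> R) : Prop :=
  forall x x', B x -> B x' -> `|g x - g x'| <= K * enorm (x - x').

(* Main.v *)
(* The maximizer y of the gap problem at x is the projection of x - F x / alpha
   on C, so |y - x| <= |F x| / alpha when x lies in C. Keeping y fixed and moving
   x along a segment d of B, the mean value theorem bounds the increment of the
   gap function by (L1 + alpha^-1 L1 L3) |d| + L3 |d|^2; cutting the segment into
   N equal pieces divides the quadratic defect by N, and N -> oo removes it. This
   avoids differentiating the gap function (Danskin's theorem). *)
Require Import Defs.
From mathcomp Require Import all_boot all_order all_algebra.
From mathcomp Require Import all_classical all_reals all_analysis.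
From mathcomp Require Import ring lra.
Import Order.TTheory GRing.Theory Num.Theory.
Import numFieldNormedType.Exports.
Local Open Scope classical_set_scope.
Local Open Scope ring_scope.

Set Implicit Arguments.
Unset Strict Implicit.
Unset Printing Implicit Defensive.

(** * Euclidean inner product and norm *)

Lemma dotvC (R : realType) (n : nat) (x y : 'rV[R]_n) : dotv x y = dotv y x.
Proof. by apply: eq_bigr => i _; rewrite mulrC. Qed.

Lemma dotvDl (R : realType) (n : nat) (x y z : 'rV[R]_n) :
  dotv (x + y) z = dotv x z + dotv y z.
Proof. by rewrite -big_split; apply: eq_bigr => i _; rewrite mxE mulrDl. Qed.

Lemma dotvZl (R : realType) (n : nat) (a : R) (x y : 'rV[R]_n) :
  dotv (a *: x) y = a * dotv x y.
Proof. by rewrite mulr_sumr; apply: eq_bigr => i _; rewrite mxE mulrA. Qed.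

Lemma dotvDr (R : realType) (n : nat) (x y z : 'rV[R]_n) :
  dotv x (y + z) = dotv x y + dotv x z.
Proof. by rewrite dotvC dotvDl !(dotvC x). Qed.

Lemma dotvZr (R : realType) (n : nat) (a : R) (x y : 'rV[R]_n) :
  dotv x (a *: y) = a * dotv x y.
Proof. by rewrite dotvC dotvZl dotvC. Qed.

Lemma dotvNl (R : realType) (n : nat) (x y : 'rV[R]_n) :
  dotv (- x) y = - dotv x y.
Proof. by rewrite -scaleN1r dotvZl mulN1r. Qed.

Lemma dotvNr (R : realType) (n : nat) (x y : 'rV[R]_n) :
  dotv x (- y) = - dotv x y.
Proof. by rewrite -scaleN1r dotvZr mulN1r. Qed.

Lemma dotvv_ge0 (R : realType) (n : nat) (x : 'rV[R]_n) : 0 <= dotv x x.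
Proof. by apply: sumr_ge0 => i _; rewrite -expr2 sqr_ge0. Qed.

Lemma dotvv_eq0 (R : realType) (n : nat) (x : 'rV[R]_n) :
  (dotv x x == 0) = (x == 0).
Proof.
apply/eqP/eqP => [/eqP|->]; last by apply: big1 => i _; rewrite mxE mul0r.
rewrite psumr_eq0 => [/allP x0|i _]; last by rewrite -expr2 sqr_ge0.
apply/rowP => i; rewrite mxE; apply/eqP.
by rewrite -sqrf_eq0 expr2; apply: x0; rewrite mem_index_enum.
Qed.

Lemma enorm_ge0 (R : realType) (n : nat) (x : 'rV[R]_n) : 0 <= enorm x.
Proof. exact: sqrtr_ge0. Qed.

Lemma sqr_enorm (R : realType) (n : nat) (x : 'rV[R]_n) :
  enorm x ^+ 2 = dotv x x.
Proof. by rewrite sqr_sqrtr ?dotvv_ge0. Qed.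

Lemma enorm_eq0 (R : realType) (n : nat) (x : 'rV[R]_n) :
  (enorm x == 0) = (x == 0).
Proof. by rewrite -sqrf_eq0 sqr_enorm dotvv_eq0. Qed.

Lemma enormZ (R : realType) (n : nat) (a : R) (x : 'rV[R]_n) :
  enorm (a *: x) = `|a| * enorm x.
Proof.
by rewrite /enorm dotvZl dotvZr mulrA -expr2 sqrtrM ?sqr_ge0// sqrtr_sqr.
Qed.

Lemma enormN (R : realType) (n : nat) (x : 'rV[R]_n) : enorm (- x) = enorm x.
Proof. by rewrite /enorm dotvNl dotvNr opprK. Qed.

Lemma enormB (R : realType) (n : nat) (x y : 'rV[R]_n) :
  enorm (x - y) = enorm (y - x).
Proof. by rewrite -enormN opprB. Qed.

Lemma Cauchy_Schwarz (R : realType) (n : nat) (x y : 'rV[R]_n) :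
  `|dotv x y| <= enorm x * enorm y.
Proof.
rewrite -ler_sqr ?nnegrE ?mulr_ge0 ?enorm_ge0// real_normK ?num_real//.
rewrite exprMn !sqr_enorm.
have [->|y0] := eqVneq y 0; first by rewrite -(scale0r 0) !dotvZr; lra.
have yy : 0 < dotv y y by rewrite lt_neqAle dotvv_ge0 eq_sym dotvv_eq0 y0.
rewrite -(ler_pM2r yy) -subr_ge0.
(* The squared norm of this vector is the difference of the two sides, each already multiplied by
   [dotv y y]. *)
have := dotvv_ge0 (dotv y y *: x - dotv x y *: y).
rewrite !(dotvDl, dotvDr, dotvNl, dotvNr, dotvZl, dotvZr) (dotvC y x).
by move=> /le_trans -> //; rewrite le_eqVlt; apply/orP; left; apply/eqP; ring.
Qed.

Lemma dotv_le (R : realType) (n : nat) (x y : 'rV[R]_n) :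
  dotv x y <= enorm x * enorm y.
Proof. exact: le_trans (ler_norm _) (Cauchy_Schwarz x y). Qed.

Lemma ler_enormD (R : realType) (n : nat) (x y : 'rV[R]_n) :
  enorm (x + y) <= enorm x + enorm y.
Proof.
rewrite -ler_sqr ?nnegrE ?addr_ge0 ?enorm_ge0// sqrrD !sqr_enorm.
rewrite !(dotvDl, dotvDr) (dotvC y x); have := dotv_le x y; lra.
Qed.

(** * Spectral norm and its Frobenius majorant *)

Definition frobnorm (R : realType) (n : nat) (A : 'M[R]_n) : R :=
  Num.sqrt (\sum_(i < n) enorm (row i A) ^+ 2).

(** Cauchy-Schwarz applied to each row of [A]. The Frobenius norm is an explicit continuous
    majorant; it controls [opnorm], which is only given as a supremum. *)
Lemma enorm_mulmx_frobnorm (R : realType) (n : nat) (A : 'M[R]_n)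
    (v : 'rV[R]_n) :
  enorm (v *m A^T) <= frobnorm A * enorm v.
Proof.
rewrite -ler_sqr ?nnegrE ?mulr_ge0 ?enorm_ge0 ?sqrtr_ge0//.
rewrite exprMn sqr_enorm sqr_sqrtr ?sumr_ge0// => [|i _]; last exact: sqr_ge0.
rewrite mulr_suml; apply: ler_sum => i _.
have -> : (v *m A^T) 0 i = dotv (row i A) v.
  by rewrite mxE; apply: eq_bigr => j _; rewrite !mxE mulrC.
rewrite -expr2 -exprMn -(real_normK (num_real (dotv _ _))).
by rewrite ler_sqr ?nnegrE ?mulr_ge0 ?enorm_ge0// Cauchy_Schwarz.
Qed.

Lemma opnorm_has_sup (R : realType) (n : nat) (A : 'M[R]_n) :
  has_sup [set enorm (v *m A^T) | v in [set v : 'rV[R]_n | enorm v <= 1]].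
Proof.
split.
  exists (enorm (0 *m A^T)), 0 => //=.
  by rewrite -(scale0r 0) enormZ normr0 mul0r.
exists (frobnorm A) => _ [v /= v1 <-].
apply: (le_trans (enorm_mulmx_frobnorm _ _)).
by rewrite ler_piMr// sqrtr_ge0.
Qed.

(** By homogeneity, a nonzero [v] can be replaced by [v] divided by its norm, which lies in the unit
    ball. *)
Lemma enorm_mulmx (R : realType) (n : nat) (A : 'M[R]_n) (v : 'rV[R]_n) :
  enorm (v *m A^T) <= opnorm A * enorm v.
Proof.
have [->|v0] := eqVneq v 0.
  by rewrite mul0mx -(scale0r (0 : 'rV[R]_n)) !enormZ normr0 !mul0r mulr0.
have v_gt0 : 0 < enorm v by rewrite lt_neqAle enorm_ge0 eq_sym enorm_eq0 v0.
rewrite -ler_pdivrMr// mulrC -[X in X * _]ger0_norm ?invr_ge0 ?enorm_ge0//.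
rewrite -enormZ scalemxAl; apply: sup_upper_bound; first exact: opnorm_has_sup.
exists ((enorm v)^-1 *: v) => //=.
by rewrite enormZ ger0_norm ?invr_ge0 ?enorm_ge0// mulVf ?gt_eqF.
Qed.

Lemma opnorm_le (R : realType) (n : nat) (A : 'M[R]_n) (k : R) : 0 <= k ->
  (forall v, enorm (v *m A^T) <= k * enorm v) -> opnorm A <= k.
Proof.
move=> k0 Ak; apply: ge_sup; first by have [] := opnorm_has_sup A.
by move=> _ [v /= v1 <-]; apply: (le_trans (Ak v)); rewrite ler_piMr.
Qed.

Lemma opnorm_ge0 (R : realType) (n : nat) (A : 'M[R]_n) : 0 <= opnorm A.
Proof.
have [[_ [v v1 _]] _] := opnorm_has_sup A.
apply: (le_trans (enorm_ge0 (v *m A^T))).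
by apply: sup_upper_bound; [exact: opnorm_has_sup|exists v].
Qed.

(** Triangle inequality for [A = B + (A - B)]. Used in both orders, it transfers continuity from
    [frobnorm] to [opnorm]. *)
Lemma opnorm_sub_le_frobnorm (R : realType) (n : nat) (A B : 'M[R]_n) :
  opnorm A - opnorm B <= frobnorm (A - B).
Proof.
rewrite lerBlDl; apply: opnorm_le => [|v].
  by rewrite addr_ge0 ?opnorm_ge0 ?sqrtr_ge0.
have -> : v *m A^T = v *m B^T + v *m (A - B)^T.
  by rewrite -mulmxDr -linearD/= addrC subrK.
apply: (le_trans (ler_enormD _ _)); rewrite mulrDl.
by apply: lerD; [exact: enorm_mulmx|exact: enorm_mulmx_frobnorm].
Qed.

(** * Continuity of the norms *)

Lemma cvg_sqrtr (R : realType) (T : Type) (G : set_system T) {FG : Filter G}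
    (f : T -> R) (a : R) :
  f t @[t --> G] --> a -> Num.sqrt (f t) @[t --> G] --> Num.sqrt a.
Proof.
by move=> fa; apply: (@continuous_cvg _ _ _ _ _ f Num.sqrt a) => //;
  exact: sqrt_continuous.
Qed.

Lemma cvg_sum_ord (R : realType) (T : Type) (G : set_system T) {FG : Filter G}
    (n : nat) (f : 'I_n -> T -> R) (a : 'I_n -> R) :
  (forall i, f i t @[t --> G] --> a i) ->
  \sum_(i < n) f i t @[t --> G] --> \sum_(i < n) a i.
Proof.
elim: n f a => [|n IHn] f a fa.
  rewrite big_ord0; under eq_fun do rewrite big_ord0; exact: cvg_cst.
rewrite big_ord_recl; under eq_fun do rewrite big_ord_recl.
by apply: cvgD => //; apply: IHn.
Qed.

Lemma cvg_dotv (R : realType) (n : nat) (T : Type) (G : set_system T)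
    {FG : Filter G} (u v : T -> 'rV[R]_n) (a b : 'rV[R]_n) :
  u t @[t --> G] --> a -> v t @[t --> G] --> b ->
  dotv (u t) (v t) @[t --> G] --> dotv a b.
Proof.
move=> ua vb; apply: cvg_sum_ord => i; apply: cvgM.
  apply: (@continuous_cvg _ _ _ _ _ u (fun M => M 0 i) a) => //.
  exact: coord_continuous.
apply: (@continuous_cvg _ _ _ _ _ v (fun M => M 0 i) b) => //.
exact: coord_continuous.
Qed.

Lemma cvg_enorm (R : realType) (n : nat) (T : Type) (G : set_system T)
    {FG : Filter G} (u : T -> 'rV[R]_n) (a : 'rV[R]_n) :
  u t @[t --> G] --> a -> enorm (u t) @[t --> G] --> enorm a.
Proof.
by move=> ua; apply: cvg_sqrtr; exact: cvg_dotv.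
Qed.

Lemma frobnorm_continuous (R : realType) (n : nat) :
  continuous (@frobnorm R n).
Proof.
move=> A; apply: (cvg_sqrtr (G := nbhs A)).
apply: cvg_sum_ord => i; under eq_fun do rewrite sqr_enorm.
rewrite sqr_enorm; apply: cvg_sum_ord => j; under eq_fun do rewrite !mxE.
by rewrite !mxE; apply: cvgM; exact: coord_continuous.
Qed.

Lemma opnorm_continuous (R : realType) (n : nat) : continuous (@opnorm R n).
Proof.
move=> A; apply/(@cvgrPdist_lt _ R^o _ (nbhs A) _) => e e0.
(* A general [u] vanishing at [A] serves both [M - A] and [A - M], one for each side of the absolute
   value. *)
have frob0 (u : 'M[R]_n -> 'M[R]_n) : continuous u -> u A = 0 ->
    \forall M \near A, frobnorm (u M) < e.
  move=> cu uA; have : frobnorm (u M) @[M --> A] --> frobnorm (u A).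
    apply: (@continuous_cvg _ _ _ (nbhs A) _ u (@frobnorm R n)); last exact: cu.
    exact: frobnorm_continuous.
  rewrite uA [X in _ --> X](_ : _ = 0); last first.
    apply/eqP; rewrite sqrtr_eq0 big1// => i _.
    by rewrite row0 sqr_enorm -(scale0r 0) dotvZl mul0r.
  by move=> /cvgr_lt; apply.
near=> M; rewrite ltr_norml ltrNl opprB.
apply/andP; split; apply: (le_lt_trans (opnorm_sub_le_frobnorm _ _)).
  near: M; apply: frob0; last exact: subrr.
  by move=> M; apply: (@cvgB _ _ _ (nbhs M) _); [exact: cvg_id|exact: cvg_cst].
near: M; apply: frob0; last exact: subrr.
by move=> M; apply: (@cvgB _ _ _ (nbhs M) _); [exact: cvg_cst|exact: cvg_id].
Unshelve. all: by end_near. Qed.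

(** * Segments and derivatives along lines *)

Lemma convex_set_segment (R : realType) (n : nat) (A : set 'rV[R]_n)
    (x y : 'rV[R]_n) (t : R) :
  convex_set A -> A x -> A y -> 0 <= t -> t <= 1 -> A (x + t *: (y - x)).
Proof.
move=> cA Ax Ay t0 t1.
(* The convex combination puts the weight [t] on its first point, hence [y] before [x]. *)
have := cA y x (Itv01 t0 t1) (mem_set Ay) (mem_set Ax).
move=> /set_mem; congr A; rewrite /conv/= /unstable.onem.
rewrite scalerBl scale1r scalerBr.
by rewrite addrCA addrA.
Qed.

Lemma is_derive_dotv (R : realType) (n : nat) (u v : R -> 'rV[R]_n)
    (du dv : 'rV[R]_n) (t : R) :
  is_derive t 1 u du -> is_derive t 1 v dv ->
  is_derive t 1 (fun s => dotv (u s) (v s)) (dotv du (v t) + dotv (u t) dv).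
Proof.
move=> udu vdv.
have coord (w : R -> 'rV[R]_n) dw i : is_derive t 1 w dw ->
    is_derive t 1 (fun s => w s 0 i : R) (dw 0 i).
  move=> [/[dup] dbw /derivable_mxP dw' <-].
  by apply: DeriveDef; [exact: dw'|rewrite derive_mx// mxE].
rewrite [X in is_derive _ _ X _](_ : _ =
  \sum_(i < n) ((fun s => u s 0 i : R) * (fun s => v s 0 i))); last first.
  by apply/funext => s; rewrite fct_sumE.
rewrite -big_split/=; apply: is_derive_sum => i.
apply: is_derive_eq (is_deriveM (coord _ _ i udu) (coord _ _ i vdv)) _.
by rewrite addrC; congr (_ + _); exact: mulrC.
Qed.

Lemma is_derive_line (R : realType) (n : nat) (x d : 'rV[R]_n) (t : R) :
  is_derive t 1 (fun s => x + s *: d) d.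
Proof.
have ds : is_diff t ( *:%R^~ d) ( *:%R^~ d) by exact: is_diff_scalel.
have := is_diffD (is_diff_cst x t) ds.
move=> [df de]; apply: DeriveDef; first exact: diff_derivable.
by rewrite deriveE// de /= add0r scale1r.
Qed.

Lemma is_derive_comp_line (R : realType) (n : nat)
    (F : 'rV[R]_n -> 'rV[R]_n) (x d : 'rV[R]_n) (t : R) :
  differentiable F (x + t *: d) ->
  is_derive t 1 (fun s => F (x + s *: d)) (d *m 'J F (x + t *: d)).
Proof.
move=> dF; have [dl le] : is_derive t 1 (fun s => x + s *: d) d.
  exact: is_derive_line.
move/derivable1_diffP in dl; rewrite deriveE// in le.
apply: DeriveDef; first exact/derivable1_diffP/differentiable_comp.
rewrite deriveE; last exact: differentiable_comp.
by rewrite diff_comp//= le -deriveE// deriveEjacobian.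
Qed.

(** * Subdivision, proximal step and variation of the objective *)

Lemma lipschitz_with_of_quadratic_defect (R : realType) (n : nat)
    (B : set 'rV[R]_n) (g : 'rV[R]_n -> R) (K M : R) : convex_set B ->
  (forall x x', B x -> B x' ->
    g x - g x' <= K * enorm (x - x') + M * enorm (x - x') ^+ 2) ->
  lipschitz_with B K g.
Proof.
move=> cB gKM; suff gK x x' : B x -> B x' -> g x - g x' <= K * enorm (x - x').
  move=> x x' Bx Bx'; rewrite ler_norml gK// andbT lerNl opprB enormB.
  exact: gK.
move=> Bx Bx'; apply/ler_addgt0Pl => e e0.
(* [N] exceeds [M * d ^+ 2 / e], so the total defect [M * d ^+ 2 / N] of the [N] pieces is at most
   [e]; the successor also keeps [N] nonzero. *)
set d := enorm (x - x'); pose N := (Num.truncn (M * d ^+ 2 / e)).+1.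
have N0 : 0 < N%:R :> R by rewrite ltr0n.
pose z i : 'rV[R]_n := x' + (i%:R / N%:R) *: (x - x').
have Bz i : (i <= N)%N -> B (z i).
  move=> iN; apply: (convex_set_segment cB Bx' Bx); first by rewrite divr_ge0.
  by rewrite ler_pdivrMr// mul1r ler_nat.
have -> : g x - g x' = \sum_(0 <= i < N) (g (z i.+1) - g (z i)).
  rewrite (telescope_sumr (fun i => g (z i)))// /z mul0r scale0r addr0.
  by rewrite divff ?gt_eqF// scale1r [x' + _]addrC subrK.
have step i : (0 <= i < N)%N ->
    g (z i.+1) - g (z i) <= K * (d / N%:R) + M * (d / N%:R) ^+ 2.
  move=> /andP[_ iN]; have := gKM _ _ (Bz _ iN) (Bz _ (ltnW iN)).
  have -> : z i.+1 - z i = N%:R^-1 *: (x - x').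
    rewrite /z opprD addrACA subrr add0r -scalerBl -mulrBl.
    by rewrite -natrB// subSnn mul1r.
  by rewrite enormZ ger0_norm ?invr_ge0 ?ler0n// [_^-1 * _]mulrC.
apply: (le_trans (ler_sum_nat step)); rewrite sumr_const_nat subn0.
have -> : (K * (d / N%:R) + M * (d / N%:R) ^+ 2) *+ N =
    K * d + M * d ^+ 2 / N%:R.
  by rewrite -[LHS]mulr_natr; field; rewrite gt_eqF.
rewrite addrC lerD2r ler_pdivrMr// [e * _]mulrC -ler_pdivrMr//.
exact/ltW/truncnS_gt.
Qed.

(** Optimality of [y] along the segment towards the feasible point [x] gives the variational
    inequality [alpha * enorm w ^+ 2 <= - dotv g w] for [w = y - x], and Cauchy-Schwarz concludes.
    Comparing [y] with [x] alone would lose a factor 2. *)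
Lemma proximal_step_le (R : realType) (n : nat) (C : set 'rV[R]_n) (alpha : R)
    (g x y : 'rV[R]_n) : convex_set C -> C x -> C y -> 0 < alpha ->
  (forall y', C y' -> - dotv g (y' - x) - alpha / 2 * enorm (y' - x) ^+ 2 <=
    - dotv g (y - x) - alpha / 2 * enorm (y - x) ^+ 2) ->
  alpha * enorm (y - x) <= enorm g.
Proof.
move=> cC Cx Cy a0 ymax; set w := y - x.
set W := alpha * enorm w ^+ 2.
(* Compare y with y + t (x - y) in C; then t -> 0 gives W <= - dotv g w. *)
have tmax t : 0 < t -> t <= 1 -> W + dotv g w <= t * (W / 2).
  move=> t0 t1; rewrite -(ler_pM2l t0).
  have := ymax _ (convex_set_segment cC Cy Cx (ltW t0) t1).
  have -> : y + t *: (x - y) - x = (1 - t) *: w.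
    by rewrite -(opprB y x) -/w scalerN scalerBl scale1r addrAC.
  rewrite !sqr_enorm -/w !(dotvZl, dotvZr) /W sqr_enorm; lra.
have Wg : W <= - dotv g w.
  (* Suppose [s = W + dotv g w] is positive. At [t = 1], [tmax] gives [s <= W / 2], so [W] is
     positive and [s / W] is at most 1; at [t = s / W] it gives [s <= s / 2], a contradiction. *)
  rewrite -subr_le0 opprK leNgt; apply/negP => s0.
  have W0 : 0 < W by have := tmax 1 ltr01 (lexx 1); lra.
  have := tmax ((W + dotv g w) / W).
  rewrite divr_gt0// ler_pdivrMr// mul1r mulrA divfK ?gt_eqF//.
  have := tmax 1 ltr01 (lexx 1).
  move=> h1 /(_ isT); have -> : W + dotv g w <= W by lra.
  by move=> /(_ isT); lra.
have [->|w0] := eqVneq w 0.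
  by rewrite -(scale0r (0 : 'rV[R]_n)) enormZ normr0 mul0r mulr0 enorm_ge0.
have w_gt0 : 0 < enorm w by rewrite lt_neqAle enorm_ge0 eq_sym enorm_eq0 w0.
rewrite -(ler_pM2r w_gt0) -mulrA -expr2; apply: (le_trans Wg).
by rewrite -dotvNr -(enormN w) dotv_le.
Qed.

(** With [y] frozen, differentiating the penalty and the factor [F z] along [d = x - x'] gives
    [alpha *: d] and minus the Jacobian applied to [d], both paired with [y - z]. They merge into
    the single matrix [alpha%:M - jacobian_mx F z], whose spectral norm is what [L3] bounds. *)
Lemma gap_objective_MVT (R : realType) (n : nat) (F : 'rV[R]_n -> 'rV[R]_n)
    (alpha : R) (x x' y : 'rV[R]_n) :
  (forall z, differentiable F z) ->
  let h z := - dotv (F z) (y - z) - alpha / 2 * enorm (y - z) ^+ 2 in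
  exists t, [/\ 0 <= t, t <= 1 & let z := x' + t *: (x - x') in
    h x - h x' = dotv (F z) (x - x') +
      dotv ((x - x') *m (alpha%:M - jacobian_mx F z)^T) (y - z)].
Proof.
move=> dF h; set d := x - x'.
pose D t := let z := x' + t *: d in
  dotv (F z) d + dotv (d *m (alpha%:M - jacobian_mx F z)^T) (y - z).
have hD (t : R) : is_derive t 1 (fun s => h (x' + s *: d)) (D t).
  have dy : is_derive t 1 (fun s => y - (x' + s *: d)) (- d).
    rewrite (_ : (fun _ => _) = (fun s => (y - x') + s *: (- d))).
      exact: is_derive_line.
    by apply/funext => s; rewrite scalerN opprD addrA.
  have dFl := is_derive_comp_line (dF (x' + t *: d)).
  have dFy := is_derive_dotv dFl dy.
  have dyy := is_derive_dotv dy dy.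
  rewrite (_ : (fun _ => _) =
    - (fun s => dotv (F (x' + s *: d)) (y - (x' + s *: d))) -
    (alpha / 2) \*: (fun s => dotv (y - (x' + s *: d)) (y - (x' + s *: d))));
    last first.
    by apply/funext => s; rewrite /h sqr_enorm.
  apply: is_derive_eq (is_deriveB (is_deriveN dFy) (is_deriveZ _ dyy)) _.
  (* The transpose in the row-vector product cancels the one in [jacobian_mx]. *)
  have JT : (alpha%:M - jacobian_mx F (x' + t *: d))^T =
      alpha%:M - 'J F (x' + t *: d).
    by rewrite linearB/= trmxK tr_scalar_mx.
  rewrite /D JT mulmxBr mul_mx_scalar.
  rewrite !(dotvDl, dotvDr, dotvNl, dotvNr, dotvZl, dotvZr).
  by rewrite /GRing.scale/= (dotvC y x) (dotvC y x') (dotvC x' x); field.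
have hc : {within `[0, 1], continuous (fun s => h (x' + s *: d))}.
  apply: continuous_subspaceT => s.
  by apply: differentiable_continuous; apply/derivable1_diffP; case: (hD s).
have [t t01] := MVT_segment ler01 (fun s _ => hD s) hc.
rewrite scale0r addr0 scale1r [x' + _]addrC subrK subr0 mulr1 => hE.
by move: t01; rewrite in_itv/= => /andP[t0 t1]; exists t.
Qed.

(** * The Lipschitz constant of the gap function *)

Theorem theorem3p3 (R : realType) (n : nat) (C : set 'rV[R]_n)
  (C_neq0 : C !=set0) (C_compact : compact C) (C_convex : convex_set C)
  (f : 'rV[R]_n -> 'rV[R]_n -> R) (F : 'rV[R]_n -> 'rV[R]_n)
  (F_C1 : continuously_differentiable F)
  (fE : forall x y, f x y = dotv (F x) (y - x))
  (B : set 'rV[R]_n)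
  (B_neq0 : B !=set0) (B_convex : convex_set B) (B_compact : compact B)
  (BC : B `<=` C)
  (alpha : R) (alpha_gt0 : 0 < alpha) :
  let L1 := set_max [set enorm (F x) | x in B] in
  let L3 := set_max [set opnorm (alpha%:M - jacobian_mx F x) | x in B] in
  lipschitz_with B (L1 + alpha^-1 * L1 * L3) (gap_function C f alpha).
Proof.
move=> L1 L3; have [dF cJ] := F_C1.
(* Continuity on the nonempty compact [B] makes [L1] and [L3] attained maxima rather than the
   default 0 of [set_max]. *)
have FL1 x : B x -> enorm (F x) <= L1.
  apply: (set_max_compact B_neq0 B_compact _).2.
  apply: continuous_subspaceT => z.
  by apply: (cvg_enorm (G := nbhs z)); exact: differentiable_continuous.
have JL3 x : B x -> opnorm (alpha%:M - jacobian_mx F x) <= L3.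
  apply: (set_max_compact B_neq0 B_compact _).2.
  apply: continuous_subspaceT => z.
  apply: (@continuous_cvg _ _ _ (nbhs z) _
    (fun z => alpha%:M - jacobian_mx F z) (@opnorm R n)).
    exact: opnorm_continuous.
  by apply: (@cvgB _ _ _ (nbhs z) _); [exact: cvg_cst|exact: cJ].
pose h x y := - dotv (F x) (y - x) - alpha / 2 * enorm (y - x) ^+ 2.
(* The same argument on [C] supplies a maximizer [y] of the gap problem at every [x]. *)
have hmax x : (exists2 y, C y & gap_function C f alpha x = h x y) /\
    forall y, C y -> h x y <= gap_function C f alpha x.
  rewrite /gap_function; under eq_imagel do rewrite fE.
  have [|[y Cy <-] ?] := set_max_compact (g := h x) C_neq0 C_compact.
    apply: continuous_subspaceT => y.
    have dy : z - x @[z --> y] --> y - x.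
      by apply: (@cvgB _ _ _ (nbhs y) _); [exact: cvg_id|exact: cvg_cst].
    rewrite /h; apply: (@cvgB _ R^o _ (nbhs y) _).
      by apply: (@cvgN _ R^o _ (nbhs y) _); apply: cvg_dotv dy; exact: cvg_cst.
    under eq_fun do rewrite sqr_enorm; rewrite sqr_enorm.
    by apply: (@cvgM _ _ (nbhs y) _); [exact: cvg_cst|exact: cvg_dotv].
  by split => //; exists y.
apply: (@lipschitz_with_of_quadratic_defect _ _ _ _ _ L3) => // x x' Bx Bx'.
have [[y Cy gx] ymax] := hmax x; rewrite gx in ymax *.
(* At [x'] the point [y] is merely a competitor, so the increment of the gap function is at most
   [h x y - h x' y]. *)
have gx' := (hmax x').2 y Cy.
have yx : enorm (y - x) <= alpha^-1 * L1.
  rewrite ler_pdivlMl//; apply: le_trans (FL1 _ Bx).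
  apply: (proximal_step_le C_convex (BC _ Bx)) => //.
have [t [t0 t1 hE]] := gap_objective_MVT alpha x x' y dF.
set z := x' + t *: (x - x') in hE; set d := x - x' in z hE *.
have Bz : B z by exact: (convex_set_segment B_convex Bx' Bx).
have d0 := enorm_ge0 d.
(* The mean value point [z] differs from [x] by at most [enorm d]; this extra term, multiplied by
   [L3 * enorm d], is the quadratic defect. *)
have yz : enorm (y - z) <= alpha^-1 * L1 + enorm d.
  have -> : y - z = (y - x) + (1 - t) *: d.
    rewrite scalerBl scale1r /z opprD !addrA; congr (_ - _).
    by rewrite subrK.
  apply: (le_trans (ler_enormD _ _)); apply: (lerD yx).
  by rewrite enormZ ger0_norm ?subr_ge0// ler_piMl// gerBl.
have L3d : enorm (d *m (alpha%:M - jacobian_mx F z)^T) <= L3 * enorm d.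
  apply: (le_trans (enorm_mulmx _ _)); exact: ler_wpM2r (JL3 _ Bz).
have Fd : dotv (F z) d <= L1 * enorm d.
  by apply: (le_trans (dotv_le _ _)); exact: ler_wpM2r (FL1 _ Bz).
have Jd := le_trans (dotv_le _ _) (ler_pM (enorm_ge0 _) (enorm_ge0 _) L3d yz).
rewrite -/(h x y) -/(h x' y) in hE.
apply: (@le_trans _ _ (h x y - h x' y)); first by rewrite lerD2l lerN2.
rewrite hE; apply: (le_trans (lerD Fd Jd)).
(* The two bounds add up exactly to the required right-hand side. *)
by rewrite le_eqVlt; apply/orP; left; apply/eqP; ring.
Qed.
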